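(* Under the assumptions of Theorem 2 (unichain and strictly indexable bandit; the unique fixed point $\mathbf m^*$ of $\phi$ is a uniform global attractor of $(\Phi_t)$; $\mathbf m^*$ non-singular), let $\mathbf M^{(N)}(0)$ be distributed according to a stationary distribution of the configuration Markov chain of the $N$-bandit system under WIP ($\alpha N\in\mathbb N$). Then there exist constants $b,c>0$, independent of $N$, such that (i) $\|\mathbb E[\mathbf M^{(N)}(0)]-\mathbf m^*\|\le b\,e^{-cN}$, and (ii) $\mathbb P(\mathbf M^{(N)}(0)\notin\mathcal Z_{s(\mathbf m^* )})\le b\,e^{-cN}$.
   Context: Synchronous restless bandit model: $d\times d$ stochastic matrices $\mathbf P^0,\mathbf P^1$, rewards $\mathbf R^0,\mathbf R^1$, $\alpha\in(0,1)$; $N$ bandits with states in $\{1,\dots,d\}$ moving independently given actions, $\mathbb P(S_n(t+1)=j\mid S_n(t)=i,a_n(t)=a)=P^a_{ij}$. Strict indexability (Whittle indices from the single-bandit subsidy-$\nu$ problem where the passive action earns $R^0_i+\nu$, nested passive sets, pairwise distinct indices) is assumed, states labeled $\nu_1>\dots>\nu_d$; unichain: every policy gives a single recurrent class. WIP activates at each step the $\alpha N$ bandits with highest indices; $\mathbf M^{(N)}(t)\in\Delta^d=\{\mathbf m\in[0,1]^d:\sum m_i=1\}$ is the vector of fractions of bandits in each state under WIP, a Markov chain. $s(\mathbf m)$ is the unique $s$ with $\sum_{i<s}m_i\le\alpha<\sum_{i\le s}m_i$; $\mathcal Z_i=\{\mathbf m\in\Delta^d:s(\mathbf m)=i\}$;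 $\phi_j(\mathbf m)=\sum_{i=1}^{s(\mathbf m)-1} m_i P^1_{ij} + (\alpha-\sum_{i=1}^{s(\mathbf m)-1}m_i)P^1_{s(\mathbf m)j} + (\sum_{i=1}^{s(\mathbf m)}m_i - \alpha)P^0_{s(\mathbf m)j} + \sum_{i=s(\mathbf m)+1}^{d} m_i P^0_{ij}$ with unique fixed point $\mathbf m^*$; $\Phi_0=\mathrm{id}$, $\Phi_{t+1}=\phi\circ\Phi_t$. Uniform global attractor: for all $\epsilon>0$ there is $T(\epsilon)$ with $\|\Phi_t(\mathbf m)-\mathbf m^*\|\le\epsilon$ for $t\ge T(\epsilon)$ and all $\mathbf m$. Singular: $\sum_{j\le i}m_j=\alpha$ for some $i$. $\|\cdot\|$ sup norm. *)

(* Defs.v *)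
From HB Require Import structures.
From mathcomp Require Import all_boot all_order all_algebra.
From mathcomp Require Import reals sequences exp.
Set Implicit Arguments. Unset Strict Implicit. Unset Printing Implicit Defensive.
Import Order.TTheory GRing.Theory Num.Theory.
Local Open Scope ring_scope.

(* States are 'I_d (label 0 = highest Whittle index, i.e. paper's state 1). *)

Definition stochastic {R : numDomainType} (d : nat) (P : 'M[R]_d) : Prop :=
  (forall i j, 0 <= P i j) /\ (forall i, \sum_(j < d) P i j = 1).

Definition simplex {R : numDomainType} (d : nat) (m : 'I_d -> R) : Prop :=
  (forall i, 0 <= m i) /\ \sum_(i < d) m i = 1.

(* s(m) = s  iff  sum_{i<s} m_i <= alpha < sum_{i<=s} m_i ;  m \in Z_s iff is_s alpha m s *)
Definition is_s {R : realDomainType} (d : nat) (alpha : R) (m : 'I_d -> R) (s : 'I_d) : bool :=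
  (\sum_(i < d | (i < s)%N) m i <= alpha) && (alpha < \sum_(i < d | (i <= s)%N) m i).

Definition phi_s {R : realDomainType} (d : nat) (alpha : R) (P0 P1 : 'M[R]_d)
  (m : 'I_d -> R) (s j : 'I_d) : R :=
  \sum_(i < d | (i < s)%N) m i * P1 i j
  + (alpha - \sum_(i < d | (i < s)%N) m i) * P1 s j
  + (\sum_(i < d | (i <= s)%N) m i - alpha) * P0 s j
  + \sum_(i < d | (s < i)%N) m i * P0 i j.

(* phi(m): on Delta^d (with 0<alpha<1) exactly one s satisfies is_s, so the
   sum below has exactly one term, namely phi_s at s = s(m). *)
Definition phi {R : realDomainType} (d : nat) (alpha : R) (P0 P1 : 'M[R]_d)
  (m : 'I_d -> R) : 'I_d -> R :=
  fun j => \sum_(s < d | is_s alpha m s) phi_s alpha P0 P1 m s j.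

Definition uniform_global_attractor {R : realDomainType} (d : nat)
  (F : ('I_d -> R) -> ('I_d -> R)) (mstar : 'I_d -> R) : Prop :=
  forall eps : R, 0 < eps -> exists T : nat, forall t : nat, (T <= t)%N ->
    forall m : 'I_d -> R, simplex m -> forall j, `|iter t F m j - mstar j| <= eps.

Definition singular {R : numDomainType} (d : nat) (alpha : R) (m : 'I_d -> R) : Prop :=
  exists i : 'I_d, \sum_(j < d | (j <= i)%N) m j = alpha.

Definition policy_matrix {R : numDomainType} (d : nat) (P0 P1 : 'M[R]_d)
  (pol : 'I_d -> bool) (i j : 'I_d) : R :=
  if pol i then P1 i j else P0 i j.

Definition reach {R : numDomainType} (d : nat) (Q : 'I_d -> 'I_d -> R) : rel 'I_d :=
  connect (fun i j : 'I_d => 0 < Q i j).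

Definition recurrent {R : numDomainType} (d : nat) (Q : 'I_d -> 'I_d -> R) (i : 'I_d) : Prop :=
  forall j, reach Q i j -> reach Q j i.

Definition unichain {R : numDomainType} (d : nat) (P0 P1 : 'M[R]_d) : Prop :=
  forall pol : 'I_d -> bool, forall i j,
    recurrent (policy_matrix P0 P1 pol) i ->
    recurrent (policy_matrix P0 P1 pol) j ->
    reach (policy_matrix P0 P1 pol) i j.

(* single bandit with subsidy nu, average-reward optimality equation *)
Definition Qpas {R : realDomainType} (d : nat) (P0 : 'M[R]_d) (R0 : 'I_d -> R)
  (nu : R) (h : 'I_d -> R) (i : 'I_d) : R :=
  R0 i + nu + \sum_(j < d) P0 i j * h j.
Definition Qact {R : realDomainType} (d : nat) (P1 : 'M[R]_d) (R1 : 'I_d -> R)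
  (h : 'I_d -> R) (i : 'I_d) : R :=
  R1 i + \sum_(j < d) P1 i j * h j.

Definition avg_opt_eq {R : realDomainType} (d : nat) (P0 P1 : 'M[R]_d)
  (R0 R1 : 'I_d -> R) (nu g : R) (h : 'I_d -> R) : Prop :=
  forall i, g + h i = Num.max (Qpas P0 R0 nu h i) (Qact P1 R1 h i).

Definition passive_opt {R : realDomainType} (d : nat) (P0 P1 : 'M[R]_d)
  (R0 R1 : 'I_d -> R) (nu : R) (i : 'I_d) : Prop :=
  forall (g : R) (h : 'I_d -> R), avg_opt_eq P0 P1 R0 R1 nu g h ->
    Qact P1 R1 h i <= Qpas P0 R0 nu h i.

(* nested passive sets; Whittle index w i = inf {nu | i in D(nu)};
   indices pairwise distinct and states labeled so that w 0 > w 1 > ... *)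
Definition strictly_indexable_labeled {R : realDomainType} (d : nat)
  (P0 P1 : 'M[R]_d) (R0 R1 : 'I_d -> R) : Prop :=
  (forall (nu nu' : R) i, nu <= nu' ->
      passive_opt P0 P1 R0 R1 nu i -> passive_opt P0 P1 R0 R1 nu' i) /\
  exists w : 'I_d -> R,
    (forall i j : 'I_d, (i < j)%N -> w j < w i) /\
    (forall i (nu : R), (w i < nu -> passive_opt P0 P1 R0 R1 nu i) /\
                        (nu < w i -> ~ passive_opt P0 P1 R0 R1 nu i)).

Definition config (d N : nat) := {ffun 'I_d -> 'I_N.+1}.

Definition counts (d N : nat) (x : {ffun 'I_N -> 'I_d}) : config d N :=
  [ffun i => inord #|[set k | x k == i]|].

(* canonical full state of a configuration: bandits sorted by state label,
   so that WIP activates exactly bandits 0..K-1 (the K = alpha N bandits of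
   highest index) *)
Definition sortedb (d N : nat) (x : {ffun 'I_N -> 'I_d}) : bool :=
  [forall k1 : 'I_N, forall k2 : 'I_N, (k1 <= k2)%N ==> (x k1 <= x k2)%N].

Definition wip_step_prob {R : realDomainType} (d N K : nat) (P0 P1 : 'M[R]_d)
  (x x' : {ffun 'I_N -> 'I_d}) : R :=
  \prod_(k < N) (if (k < K)%N then P1 (x k) (x' k) else P0 (x k) (x' k)).

Definition config_kernel {R : realDomainType} (d N K : nat) (P0 P1 : 'M[R]_d)
  (n n' : config d N) : R :=
  \sum_(x : {ffun 'I_N -> 'I_d} | (counts x == n) && sortedb x)
    \sum_(x' : {ffun 'I_N -> 'I_d} | counts x' == n') wip_step_prob K P0 P1 x x'.

Definition stationary {R : realDomainType} (d N K : nat) (P0 P1 : 'M[R]_d)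
  (pi : config d N -> R) : Prop :=
  (forall n, 0 <= pi n) /\ \sum_(n : config d N) pi n = 1 /\
  (forall n' : config d N, pi n' = \sum_(n : config d N) pi n * config_kernel K P0 P1 n n').

Definition fracM {R : realFieldType} (d N : nat) (n : config d N) : 'I_d -> R :=
  fun i => (n i)%:R / N%:R.

(* Main.v *)
Require Import Defs.
From HB Require Import structures.
From mathcomp Require Import all_boot all_order all_algebra.
From mathcomp Require Import reals sequences exp.
From mathcomp Require Import boolp ring lra.
Import Order.TTheory GRing.Theory Num.Theory.
Local Open Scope ring_scope.

(* The map [phi] is piecewise affine, Lipschitz on the simplex, and gives the exact
   conditional mean of the next empirical measure because [alpha * N] is an integer.
   A Chernoff bound shows that one WIP step deviates from [phi] by more than [del]
   with probability exponentially small in [N].  Under a stationary law the empirical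
   measure is also that of [T] steps later, hence exponentially likely to be close to
   some [Phi_T m0], and so to [mstar] by the uniform attractor property; since [mstar]
   is not singular, this gives (ii).  For (i), [phi] is affine on the zone of [mstar],
   with linear part [A], so the bias [e = E[M] - mstar] satisfies [e = e A + r] with
   [r] bounded by the probability of leaving the zone.  The attractor property forces
   some power of [A] to be a contraction on vectors of zero sum, so [e] is
   exponentially small as well. *)

(** * The mean-field map *)

Definition cum {R : realDomainType} {d : nat} (m : 'I_d -> R) (k : nat) : R :=
  \sum_(i < d | (i < k)%N) m i.

(** The mass of state [i] that is activated when the budget [alpha] is spent on states in increasing
    label order. Clipped cumulative sums avoid any case split on the critical state, so continuity
    in [m] is visible. *)
Definition active_mass {R : realDomainType} {d : nat} (alpha : R)
  (m : 'I_d -> R) (i : 'I_d) : R :=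
  Num.min alpha (cum m i.+1) - Num.min alpha (cum m i).

Lemma is_sE {R : realDomainType} {d} (alpha : R) (m : 'I_d -> R) (s : 'I_d) :
  is_s alpha m s = (cum m s <= alpha) && (alpha < cum m s.+1).
Proof. by []. Qed.

Lemma cum0 {R : realDomainType} {d} (m : 'I_d -> R) : cum m 0 = 0.
Proof. by rewrite /cum big_pred0. Qed.

Lemma cumS {R : realDomainType} {d} (m : 'I_d -> R) (i : 'I_d) :
  cum m i.+1 = cum m i + m i.
Proof.
rewrite /cum (bigD1 i) //= addrC; congr (_ + _).
by apply: eq_bigl => j; rewrite ltnS andbC ltn_neqAle.
Qed.

Lemma cum_full {R : realDomainType} {d} (m : 'I_d -> R) :
  cum m d = \sum_i m i.
Proof. by rewrite /cum; apply: eq_bigl => i; rewrite ltn_ord. Qed.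

Lemma cum_mono {R : realDomainType} {d} (m : 'I_d -> R) (k l : nat) :
  (forall i, 0 <= m i) -> (k <= l)%N -> cum m k <= cum m l.
Proof.
move=> m0 kl; rewrite /cum [leRHS](bigID (fun i : 'I_d => (i < k)%N)) /=.
rewrite [X in _ <= X + _](eq_bigl (fun i : 'I_d => (i < k)%N)) => [|i].
  by rewrite lerDl sumr_ge0.
by case: (ltnP i k) => ik; rewrite ?andbF // (leq_trans ik kl).
Qed.

Lemma cum_dist {R : realDomainType} {d} (m m' : 'I_d -> R) (k : nat) (e : R) :
  (forall i, `|m i - m' i| <= e) -> 0 <= e -> `|cum m k - cum m' k| <= d%:R * e.
Proof.
move=> me e0; rewrite /cum -sumrB (le_trans (ler_norm_sum _ _ _)) //.
rewrite big_mkcond /=.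
have -> : d%:R * e = \sum_(i < d) e by rewrite sumr_const card_ord mulr_natl.
by apply: ler_sum => i _; case: ifP.
Qed.

Lemma min_dist {R : realDomainType} (a x y : R) :
  `|Num.min a x - Num.min a y| <= `|x - y|.
Proof.
have := ler_norm (x - y); have := ler_norm (- (x - y)); rewrite normrN ler_norml.
by case: (lerP a x) => h1; case: (lerP a y) => h2 *; lra.
Qed.

Lemma active_mass_dist {R : realDomainType} {d} (alpha : R) (m m' : 'I_d -> R) i (e : R) :
  (forall i, `|m i - m' i| <= e) -> 0 <= e ->
  `|active_mass alpha m i - active_mass alpha m' i| <= 2 * d%:R * e.
Proof.
move=> me e0; pose c (f : 'I_d -> R) k := Num.min alpha (cum f k).
have -> : active_mass alpha m i - active_mass alpha m' i
  = (c m i.+1 - c m' i.+1) - (c m i - c m' i) by rewrite /active_mass /c; ring.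
apply: (le_trans (ler_normB _ _)).
have h k := le_trans (min_dist alpha (cum m k) (cum m' k)) (cum_dist m m' k e me e0).
have := h i.+1; have := h i; rewrite /c; lra.
Qed.

Lemma active_mass_ge0 {R : realDomainType} {d} (alpha : R) (m : 'I_d -> R) i :
  (forall i, 0 <= m i) -> 0 <= active_mass alpha m i.
Proof.
move=> m0; have := m0 i; rewrite /active_mass cumS.
by case: (lerP alpha (cum m i + m i)) => h1; case: (lerP alpha (cum m i)) => h2 *; lra.
Qed.

Lemma active_mass_le {R : realDomainType} {d} (alpha : R) (m : 'I_d -> R) i :
  (forall i, 0 <= m i) -> active_mass alpha m i <= m i.
Proof.
move=> m0; have := m0 i; rewrite /active_mass cumS.
by case: (lerP alpha (cum m i + m i)) => h1; case: (lerP alpha (cum m i)) => h2 *; lra.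
Qed.

Definition mean_flow {R : realDomainType} {d : nat} (P0 P1 : 'M[R]_d)
  (m a : 'I_d -> R) (j : 'I_d) : R :=
  \sum_i (a i * P1 i j + (m i - a i) * P0 i j).

Lemma is_s_uniq {R : realDomainType} {d} (alpha : R) (m : 'I_d -> R) (s s' : 'I_d) :
  (forall i, 0 <= m i) -> is_s alpha m s -> is_s alpha m s' -> s = s'.
Proof.
move=> m0; rewrite !is_sE => /andP[h1 h2] /andP[h3 h4]; apply/val_inj/eqP => /=.
case: (ltngtP s s') => // lt.
- by have := cum_mono m _ _ m0 lt; lra.
- by have := cum_mono m _ _ m0 lt; lra.
Qed.

Lemma is_s_exists {R : realDomainType} {d} (alpha : R) (m : 'I_d -> R) :
  0 <= alpha < 1 -> simplex m -> exists s, is_s alpha m s.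
Proof.
move=> /andP[a0 a1] [m0 m1].
have ex : exists k, alpha < cum m k by exists d; rewrite cum_full m1.
(* The least [k] with [alpha < cum m k] is positive because [cum m 0 = 0]; its predecessor is the
   critical state. *)
case: (ex_minnP ex) => -[|k] hk kmin; first by rewrite cum0 in hk; lra.
have kd : (k < d)%N.
  by apply: (kmin d); rewrite cum_full m1.
exists (Ordinal kd); rewrite is_sE /= hk andbT leNgt.
by apply/negP => /kmin; rewrite ltnn.
Qed.

Lemma phi_is_s {R : realDomainType} {d} (alpha : R) (P0 P1 : 'M[R]_d) m s j :
  (forall i, 0 <= m i) -> is_s alpha m s ->
  phi alpha P0 P1 m j = phi_s alpha P0 P1 m s j.
Proof.
move=> m0 ms; rewrite /phi (bigD1 s) //= big1 ?addr0 // => s' /andP[ms'].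
by rewrite (is_s_uniq alpha m s s') ?eqxx.
Qed.

Lemma active_mass_is_s {R : realDomainType} {d} (alpha : R) m (s i : 'I_d) :
  (forall i, 0 <= m i) -> is_s alpha m s ->
  active_mass alpha m i =
    if (i < s)%N then m i else if i == s then alpha - cum m s else 0.
Proof.
move=> m0; rewrite is_sE => /andP[h1 h2]; rewrite /active_mass.
case: (ltngtP i s) => [lt|lt|/val_inj ->].
- have := cum_mono m _ _ m0 lt; have := m0 i; rewrite (cumS m i) => *.
  by rewrite !min_r //; lra.
- have -> : (i == s) = false by apply/negbTE; rewrite -val_eqE /= gtn_eqF.
  have := cum_mono m _ _ m0 lt; have := m0 i; rewrite (cumS m i) => *.
  by rewrite !min_l ?subrr //; lra.
- by rewrite eqxx min_l ?min_r //; exact: ltW.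
Qed.

(** Removes [s(m)] from the formula for [phi]: states before it are fully active, states after it
    passive, and it receives the remaining budget. Both the Lipschitz bound across zone boundaries
    and the conditional mean of a WIP step start from this form. *)
Lemma phi_flow {R : realDomainType} {d} (alpha : R) (P0 P1 : 'M[R]_d) m j :
  0 <= alpha < 1 -> simplex m ->
  phi alpha P0 P1 m j = mean_flow P0 P1 m (active_mass alpha m) j.
Proof.
move=> a01 sm; have [s ms] := is_s_exists alpha m a01 sm; have [m0 m1] := sm.
rewrite (phi_is_s _ _ _ _ s) // /mean_flow /phi_s.
rewrite [RHS](bigID (fun i : 'I_d => (i < s)%N)) /=.
rewrite [in RHS](bigD1 (P := fun i : 'I_d => ~~ (i < s)%N) s) ?ltnn //=.
rewrite (active_mass_is_s _ _ s) // ltnn eqxx -/(cum m s).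
rewrite -[\sum_(i < d | (i <= s)%N) m i]/(cum m s.+1) cumS.
rewrite -!addrA; congr (_ + _).
  by apply: eq_bigr => i lt; rewrite (active_mass_is_s _ _ s) // lt; ring.
congr (_ + _); rewrite [m s + _]addrC.
congr (_ + _).
  by congr (_ * _); ring.
apply: eq_big => i; first by rewrite -leqNgt ltn_neqAle andbC eq_sym.
move=> lt; rewrite (active_mass_is_s _ _ s) // ltnNge (ltnW lt) /=.
have -> : (i == s) = false by apply/negbTE; rewrite -val_eqE /= gtn_eqF.
ring.
Qed.

Lemma stochastic_le1 {R : realDomainType} {d} (P : 'M[R]_d) i j :
  stochastic P -> P i j <= 1.
Proof.
move=> [P0 P1]; rewrite -(P1 i) (bigD1 j) //= lerDl.
by apply: sumr_ge0.
Qed.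

Lemma phi_simplex {R : realDomainType} {d} (alpha : R) (P0 P1 : 'M[R]_d) m :
  stochastic P0 -> stochastic P1 -> 0 <= alpha < 1 -> simplex m ->
  simplex (phi alpha P0 P1 m).
Proof.
move=> [P00 P01] [P10 P11] a01 sm; have [m0 m1] := sm; split.
  move=> j; rewrite phi_flow // sumr_ge0 // => i _.
  apply: addr_ge0; apply: mulr_ge0 => //; first exact: active_mass_ge0.
  by rewrite subr_ge0; apply: active_mass_le.
under eq_bigr do rewrite phi_flow //.
rewrite /mean_flow exchange_big /= -[RHS]m1; apply: eq_bigr => i _.
by rewrite big_split /= -!mulr_sumr P01 P11; ring.
Qed.

Lemma iter_phi_simplex {R : realDomainType} {d} (alpha : R) (P0 P1 : 'M[R]_d) m t :
  stochastic P0 -> stochastic P1 -> 0 <= alpha < 1 -> simplex m ->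
  simplex (iter t (phi alpha P0 P1) m).
Proof. by move=> *; elim: t => //= t IH; apply: phi_simplex. Qed.

Lemma simplex_le1 {R : realDomainType} {d} (m : 'I_d -> R) i : simplex m -> m i <= 1.
Proof. by move=> [m0 <-]; rewrite (bigD1 i) //= lerDl sumr_ge0. Qed.

(** Each of the [d] source states contributes [2 * d] through its active mass times [P1], again
    [2 * d] through the same mass times [P0], and [1] through [m i] itself. *)
Definition phi_lip (R : realDomainType) (d : nat) : R := d%:R * (4 * d%:R + 1).

Lemma phi_lip_ge0 {R : realDomainType} d : 0 <= phi_lip R d.
Proof. by rewrite /phi_lip mulr_ge0 ?addr_ge0 ?mulr_ge0. Qed.

Lemma phi_dist {R : realDomainType} {d} (alpha : R) (P0 P1 : 'M[R]_d) m m' (e : R) j :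
  stochastic P0 -> stochastic P1 -> 0 <= alpha < 1 -> simplex m -> simplex m' ->
  0 <= e -> (forall i, `|m i - m' i| <= e) ->
  `|phi alpha P0 P1 m j - phi alpha P0 P1 m' j| <= phi_lip R d * e.
Proof.
move=> s0 s1 a01 sm sm' e0 me; rewrite !phi_flow // /mean_flow -sumrB.
apply: (le_trans (ler_norm_sum _ _ _)).
have -> : phi_lip R d * e = \sum_(i < d) (4 * d%:R + 1) * e.
  by rewrite sumr_const card_ord /phi_lip -[RHS]mulr_natl mulrA.
apply: ler_sum => i _.
set a := active_mass _ _ _; set a' := active_mass _ _ _.
have -> : a * P1 i j + (m i - a) * P0 i j - (a' * P1 i j + (m' i - a') * P0 i j)
  = (a - a') * P1 i j - (a - a') * P0 i j + (m i - m' i) * P0 i j by ring.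
have ha : `|a - a'| <= 2 * d%:R * e by apply: active_mass_dist.
have dec (P : 'M[R]_d) x y : stochastic P -> `|x| <= y -> `|x * P i j| <= y.
  move=> sP xy; rewrite normrM (le_trans _ xy) // ler_piMr //.
  by rewrite ger0_norm ?stochastic_le1 //; case: sP.
have h1 := dec _ _ _ s1 ha; have h2 := dec _ _ _ s0 ha; have h3 := dec _ _ _ s0 (me i).
apply: (le_trans (ler_normD _ _)); apply: (le_trans (lerD (ler_normB _ _) (lexx _))).
by move: h1 h2 h3; lra.
Qed.

(** * Concentration for product laws *)

(* From [expR (- x) >= 1 - x] one gets [expR x <= 1 / (1 - x)]. *)
Lemma expR_le_quadratic {R : realType} (x : R) :
  `|x| <= 1 / 2 -> expR x <= 1 + x + 2 * x ^+ 2.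
Proof.
rewrite ler_norml => /andP[x1 x2].
have h := expR_ge1Dx (- x); have p : 0 < 1 - x by lra.
have : expR x * (1 - x) <= 1.
  by rewrite -[leRHS](expRxMexpNx_1 x) ler_pM2l ?expR_gt0.
rewrite -ler_pdivlMr // => /le_trans; apply.
(* Here [(1 - x) * (1 + x + 2 * x ^+ 2) = 1 + x ^+ 2 * (1 - 2 * x)], which is at least [1]. *)
rewrite ler_pdivrMr //; have : 0 <= x ^+ 2 * (1 - 2 * x).
  by rewrite mulr_ge0 ?sqr_ge0 //; lra.
lra.
Qed.

(** Factoring out [expR (- l * p)] leaves [1 + p * (expR l - 1)], at most [expR (p * (expR l - 1))];
    the quadratic bound on [expR l] then cancels the linear terms of the exponent. *)
Lemma bernoulli_mgf {R : realType} (p l : R) : 0 <= p <= 1 -> `|l| <= 1 / 2 ->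
  p * expR (l * (1 - p)) + (1 - p) * expR (l * (0 - p)) <= expR (2 * l ^+ 2).
Proof.
move=> /andP[p0 p1] hl.
have -> : l * (1 - p) = l + l * (0 - p) by ring.
rewrite expRD mulrA -mulrDl.
have h := expR_le_quadratic l hl.
apply: (@le_trans _ _ (expR (p * (expR l - 1)) * expR (l * (0 - p)))).
  rewrite ler_pM2r ?expR_gt0 //; apply: le_trans (expR_ge1Dx _); lra.
rewrite -expRD ler_expR; have : 0 <= l ^+ 2 by apply: sqr_ge0.
nra.
Qed.

Lemma product_mgf {R : realType} {I T : finType} (p : I -> T -> R) (j : T) (l : R) :
  (forall k i, 0 <= p k i) -> (forall k, \sum_i p k i = 1) -> `|l| <= 1 / 2 ->
  \sum_(x : {ffun I -> T}) (\prod_k p k (x k)) *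
      expR (l * \sum_k ((x k == j)%:R - p k j))
    <= expR (2 * l ^+ 2 * #|I|%:R).
Proof.
move=> p0 p1 hl.
under eq_bigr do rewrite mulr_sumr expR_sum -big_split /=.
(* Independence: the sum over all functions of a product is the product of the one-coordinate
   sums. *)
rewrite -(bigA_distr_bigA (fun k i => p k i * expR (l * ((i == j)%:R - p k j)))).
rewrite mulr_natr -sumr_const expR_sum; apply: ler_prod => k _.
rewrite sumr_ge0 /= => [|i _]; last by rewrite mulr_ge0 // expR_ge0.
rewrite (bigD1 j) //= eqxx.
have e : \sum_(i | i != j) p k i = 1 - p k j.
  by have := p1 k; rewrite (bigD1 j) //= => <-; ring.
rewrite (eq_bigr (fun i => p k i * expR (l * (0 - p k j)))); last first.
  by move=> i /negbTE ->.
rewrite -mulr_suml e; apply: bernoulli_mgf => //.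
by rewrite p0 /= -subr_ge0 -e sumr_ge0.
Qed.

(** Chernoff bound with [l = del / 4] and [l = - (del / 4)], one for each tail. The exponent is [2 *
    (del / 4) ^+ 2 - del ^+ 2 / 4 = - (del ^+ 2 / 8)] per coordinate, and [del <= 2] keeps [l] in
    the range of [product_mgf]. *)
Lemma product_tail {R : realType} {I T : finType} (p : I -> T -> R) (j : T) (del : R) :
  (forall k i, 0 <= p k i) -> (forall k, \sum_i p k i = 1) -> 0 < del <= 2 ->
  \sum_(x : {ffun I -> T} |
      del * #|I|%:R < `|\sum_k ((x k == j)%:R - p k j)|) \prod_k p k (x k)
    <= 2 * expR (- (del ^+ 2 / 8 * #|I|%:R)).
Proof.
move=> p0 p1 /andP[d0 d2].
have hl : `|del / 4| <= 1 / 2 by rewrite ger0_norm; lra.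
have hl' : `|- (del / 4)| <= 1 / 2 by rewrite normrN.
have := lerD (product_mgf p j _ p0 p1 hl) (product_mgf p j _ p0 p1 hl').
set n := #|I|%:R; rewrite -big_split /= => h.
have c : 0 < expR (- (del / 4 * (del * n))) by apply: expR_gt0.
have {h} := h; rewrite -(ler_pM2r c) => h; apply: le_trans (le_trans h _); last first.
  rewrite sqrrN mulrDl -!expRD.
  have : expR (2 * (del / 4) ^+ 2 * n - del / 4 * (del * n)) <= expR (- (del ^+ 2 / 8 * n)).
    by rewrite ler_expR; lra.
  lra.
rewrite big_mkcond mulr_suml; apply: ler_sum => x _.
rewrite -mulrDr -mulrA; set S := \sum_k _.
have w : 0 <= \prod_k p k (x k) by apply: prodr_ge0.
case: ifP => [hS|_]; last first.
  by rewrite mulr_ge0 // mulr_ge0 ?expR_ge0 // addr_ge0 ?expR_ge0.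
rewrite -[leLHS]mulr1 ler_wpM2l // mulrDl -!expRD.
(* On the event, one of the two exponents is nonnegative, so the corresponding exponential alone
   dominates the indicator. *)
have big1 (y : R) : 0 <= y -> 1 <= expR y.
  by move=> y0; have := expR_ge1Dx y; lra.
move: hS; rewrite lter_normr => /orP[] hS.
- have := big1 (del / 4 * S - (del / 4 * (del * n))).
  have := expR_ge0 (- (del / 4) * S - (del / 4 * (del * n))).
  nra.
- have := big1 (- (del / 4) * S - (del / 4 * (del * n))).
  have := expR_ge0 ((del / 4) * S - (del / 4 * (del * n))).
  nra.
Qed.

(** * Linear dynamics in the zone of the fixed point *)

Lemma zone_nbhd {R : realFieldType} {d} (alpha : R) (m : 'I_d -> R) (s : 'I_d) :
  0 < alpha -> is_s alpha m s -> ~ singular alpha m ->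
  exists2 eps : R, 0 < eps &
    forall m', (forall i, `|m' i - m i| <= eps) -> is_s alpha m' s.
Proof.
move=> a0; rewrite is_sE => /andP[h1 h2] ns.
(* Equality would make [m] singular at the state just before [s]; if [s] is the first state, it
   would contradict [0 < alpha]. *)
have h3 : cum m s < alpha.
  rewrite lt_neqAle h1 andbT; apply/eqP => e; apply: ns.
  case: s h1 h2 e => -[|k] kd /= h1 h2 e; first by rewrite cum0 in e; lra.
  by exists (Ordinal (ltnW kd)).
have [g g0 [g1 g2]] : exists2 g, 0 < g & g <= alpha - cum m s /\ g <= cum m s.+1 - alpha.
  exists (Num.min (alpha - cum m s) (cum m s.+1 - alpha)); first by rewrite lt_min; lra.
  by split; rewrite ge_min lexx ?orbT.
have d0 : 0 < d.+1%:R :> R by rewrite ltr0n.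
(* Cumulative sums move by at most [d] times the perturbation; dividing by [d.+1] keeps this
   strictly below the gap [g]. *)
exists (g / d.+1%:R); first exact: divr_gt0.
move=> m' mm'; have e0 : 0 <= g / d.+1%:R by rewrite ltW // divr_gt0.
have dg : d%:R * (g / d.+1%:R) < g.
  rewrite mulrA ltr_pdivrMr // mulrC ltr_pM2l // ltr_nat //.
have := cum_dist m' m s _ mm' e0; have := cum_dist m' m s.+1 _ mm' e0.
move: (d%:R * _) dg => q dg; rewrite is_sE !ler_norml => /andP[? ?] /andP[? ?].
by apply/andP; split; lra.
Qed.

(** Linear part of [phi_s]: mass added to a state before [s] follows [P1] but also displaces as much
    mass of [s] from active to passive, hence the correction by row [s]. *)
Definition zone_mx {R : realDomainType} {d} (P0 P1 : 'M[R]_d) (s : 'I_d) : 'M[R]_d :=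
  \matrix_(i, j) (if (i < s)%N then P1 i j - P1 s j + P0 s j else P0 i j).

Lemma phi_s_affine {R : realDomainType} {d} (alpha : R) (P0 P1 : 'M[R]_d) m s j :
  phi_s alpha P0 P1 m s j =
    \sum_i m i * zone_mx P0 P1 s i j + alpha * (P1 s j - P0 s j).
Proof.
rewrite /phi_s -[\sum_(i < d | (i <= s)%N) m i]/(cum m s.+1) cumS /cum.
rewrite [in RHS](bigID (fun i : 'I_d => (i < s)%N)) /=.
rewrite [in RHS](bigD1 (P := fun i : 'I_d => ~~ (i < s)%N) s) ?ltnn //=.
have -> : \sum_(i < d | (i < s)%N) m i * zone_mx P0 P1 s i j =
  \sum_(i < d | (i < s)%N) m i * P1 i j + (\sum_(i < d | (i < s)%N) m i) * (P0 s j - P1 s j).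
  by rewrite mulr_suml -big_split /=; apply: eq_bigr => i lt; rewrite mxE lt; ring.
have -> : \sum_(i < d | ~~ (i < s)%N && (i != s)) m i * zone_mx P0 P1 s i j =
  \sum_(i < d | (s < i)%N) m i * P0 i j.
  apply: eq_big => i; first by rewrite -leqNgt [RHS]ltn_neqAle andbC eq_sym.
  by case/andP => /negbTE lt _; rewrite mxE lt.
rewrite mxE ltnn; ring.
Qed.

Lemma zone_mx_le2 {R : realDomainType} {d} (P0 P1 : 'M[R]_d) s i j :
  stochastic P0 -> stochastic P1 -> `|zone_mx P0 P1 s i j| <= 2.
Proof.
move=> s0 s1; have b (P : 'M[R]_d) k : stochastic P -> 0 <= P k j <= 1.
  by move=> sP; rewrite stochastic_le1 // andbT; case: sP.
have := b _ i s0; have := b _ i s1; have := b _ s s0; have := b _ s s1.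
by rewrite mxE ler_norml; case: ifP => _; lra.
Qed.

Definition l1 {R : realDomainType} {d} (v : 'rV[R]_d) : R := \sum_j `|v 0 j|.

Lemma l1_add {R : realDomainType} {d} (u v : 'rV[R]_d) : l1 (u + v) <= l1 u + l1 v.
Proof. by rewrite /l1 -big_split; apply: ler_sum => j _; rewrite mxE ler_normD. Qed.

Lemma l1_sum {R : realDomainType} {d} n (u : 'I_n -> 'rV[R]_d) :
  l1 (\sum_i u i) <= \sum_i l1 (u i).
Proof.
elim/big_ind2: _ => // [|x x' y y' h h'].
  by rewrite /l1 big1 // => j _; rewrite mxE normr0.
exact: le_trans (l1_add _ _) (lerD h h').
Qed.

Lemma l1_mulmx {R : realDomainType} {d} (v : 'rV[R]_d) (A : 'M[R]_d) (c : R) :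
  (forall i j, `|A i j| <= c) -> l1 (v *m A) <= c * d%:R * l1 v.
Proof.
move=> Ac; have -> : c * d%:R * l1 v = \sum_(j < d) c * l1 v.
  by rewrite sumr_const card_ord -[RHS]mulr_natr mulrAC.
apply: ler_sum => j _; rewrite mxE (le_trans (ler_norm_sum _ _ _)) // mulr_sumr.
by apply: ler_sum => i _; rewrite normrM mulrC ler_wpM2r.
Qed.

Lemma l1_mulmx_exp {R : realDomainType} {d} (v : 'rV[R]_d) (A : 'M[R]_d) (c : R) t :
  (forall i j, `|A i j| <= c) -> 0 <= c -> l1 (v *m A ^+ t) <= (c * d%:R) ^+ t * l1 v.
Proof.
move=> Ac c0; elim: t => [|t IH]; first by rewrite expr0 mulmx1 mul1r.
rewrite exprSr mulmxA (le_trans (l1_mulmx _ _ _ Ac)) // exprS -[leRHS]mulrA.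
by rewrite ler_wpM2l // mulr_ge0.
Qed.

(** Unrolling [e = e *m A + r] for [T] steps gives [e *m A ^+ T] plus [T] images of [r]. The first
    term is at most half of [e] and is absorbed on the left, whence the factor [2] in [C]. *)
Lemma perturbation_bound {R : realFieldType} {d} (A : 'M[R]_d) (c : R) (T : nat) :
  (forall i j, `|A i j| <= c) -> 0 <= c ->
  (forall v : 'rV[R]_d, \sum_i v 0 i = 0 -> l1 (v *m A ^+ T) <= l1 v / 2) ->
  exists2 C, 0 <= C & forall e r : 'rV[R]_d,
    \sum_i e 0 i = 0 -> e = e *m A + r -> l1 e <= C * l1 r.
Proof.
move=> Ac c0 contr; pose C := 2 * \sum_(t < T) (c * d%:R) ^+ t.
exists C.
  by rewrite mulr_ge0 // sumr_ge0 // => t _; rewrite exprn_ge0 // mulr_ge0.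
move=> e r e0 er.
have iterE t : e = e *m A ^+ t + \sum_(u < t) r *m A ^+ u.
  elim: t => [|t IH]; first by rewrite big_ord0 expr0 mulmx1 addr0.
  rewrite big_ord_recr /= [X in _ + X]addrC addrA exprS mulmxA -mulmxDl -er.
  exact: IH.
have h1 : l1 e <= l1 e / 2 + \sum_(u < T) (c * d%:R) ^+ u * l1 r.
  rewrite {1}(iterE T) (le_trans (l1_add _ _)) // lerD ?contr //.
  rewrite (le_trans (l1_sum _ _)) //.
  by apply: ler_sum => u _; exact: l1_mulmx_exp.
by move: h1; rewrite -mulr_suml /C; lra.
Qed.

(** Controls the orbit over a finite horizon, before the attractor property takes effect. *)
Lemma iter_phi_dist {R : realDomainType} {d} (alpha : R) (P0 P1 : 'M[R]_d) mstar m (e : R) t :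
  stochastic P0 -> stochastic P1 -> 0 <= alpha < 1 -> simplex mstar -> simplex m ->
  (forall j, phi alpha P0 P1 mstar j = mstar j) -> 0 <= e ->
  (forall j, `|m j - mstar j| <= e) ->
  forall j, `|iter t (phi alpha P0 P1) m j - mstar j| <= phi_lip R d ^+ t * e.
Proof.
move=> s0 s1 a01 sm' sm fix_ e0 me; elim: t => [|t IH] j; first by rewrite mul1r.
rewrite iterS -[X in _ - X]fix_ exprS -mulrA; apply: phi_dist => //.
  exact: iter_phi_simplex.
by rewrite mulr_ge0 // exprn_ge0 // phi_lip_ge0.
Qed.

(** The orbit and the fixed point see the same affine map, so its constant term cancels in the
    difference. *)
Lemma zone_orbit {R : realDomainType} {d} (alpha : R) (P0 P1 : 'M[R]_d) mstar m s t :
  stochastic P0 -> stochastic P1 -> 0 <= alpha < 1 -> simplex mstar -> simplex m ->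
  (forall j, phi alpha P0 P1 mstar j = mstar j) -> is_s alpha mstar s ->
  (forall t, is_s alpha (iter t (phi alpha P0 P1) m) s) ->
  \row_j (iter t (phi alpha P0 P1) m j - mstar j) =
    \row_j (m j - mstar j) *m zone_mx P0 P1 s ^+ t.
Proof.
move=> s0 s1 a01 [sm' _] sm fix_ iss orb; elim: t => [|t IH]; first by rewrite expr0 mulmx1.
rewrite exprSr mulmxA -IH; apply/rowP => j; rewrite !mxE /=.
have [pos _] := iter_phi_simplex alpha P0 P1 m t s0 s1 a01 sm.
rewrite (phi_is_s _ _ _ _ s) //.
rewrite -{1}(fix_ j) (phi_is_s _ _ _ _ s) // !phi_s_affine.
rewrite opprD addrACA subrr addr0 -sumrB; apply: eq_bigr => i _.
by rewrite !mxE mulrBl.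
Qed.

(* Starting from [mstar + del (e_i - mstar)] the orbit never leaves the zone of
   [mstar], so it is linear; the attractor property then bounds [(e_i - mstar) A^t],
   and these vectors span the vectors of zero sum. *)
Lemma zone_contraction {R : realFieldType} {d} (alpha : R) (P0 P1 : 'M[R]_d) mstar s :
  stochastic P0 -> stochastic P1 -> 0 < alpha < 1 -> simplex mstar ->
  (forall j, phi alpha P0 P1 mstar j = mstar j) ->
  uniform_global_attractor (phi alpha P0 P1) mstar ->
  ~ singular alpha mstar -> is_s alpha mstar s ->
  exists T : nat, forall v : 'rV[R]_d, \sum_i v 0 i = 0 ->
    l1 (v *m zone_mx P0 P1 s ^+ T) <= l1 v / 2.
Proof.
move=> s0 s1 /andP[a0 a1] sm fix_ attr ns iss.
have a01 : 0 <= alpha < 1 by rewrite ltW.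
have d0 : 0 < d%:R :> R by rewrite ltr0n (leq_trans _ (ltn_ord s)).
have [eps eps0 nb] := zone_nbhd alpha mstar s a0 iss ns.
have [T0 hT0] := attr _ eps0.
(* Adding [1] makes the powers of [L] nondecreasing, so [L ^+ T0] serves all times up to [T0]. *)
pose L := phi_lip R d + 1.
have L1 : 1 <= L by rewrite lerDr phi_lip_ge0.
have LT0 : 0 < L ^+ T0 by rewrite exprn_gt0; lra.
(* The cap [1] makes [m i] a convex combination of [mstar] and a vertex; the other bound keeps the
   orbit within [eps] before time [T0], after which the attractor takes over. *)
pose del := Num.min 1 (eps / L ^+ T0).
have del0 : 0 < del by rewrite lt_min ltr01 divr_gt0.
have del1 : del <= 1 by rewrite ge_min lexx.
have delL : L ^+ T0 * del <= eps.
  by rewrite mulrC -ler_pdivlMr // ge_min lexx orbT.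
pose w (i : 'I_d) : 'rV[R]_d := \row_j ((j == i)%:R - mstar j).
pose m (i j : 'I_d) := mstar j + del * w i 0 j.
have sm_m i : simplex (m i).
  have [p q] := sm; split=> [j|].
    rewrite /m mxE; have := p j; have : 0 <= (j == i)%:R :> R by [].
    have := del0; nra.
  rewrite big_split /= q -mulr_sumr.
  under eq_bigr do rewrite mxE.
  by rewrite sumrB q (bigD1 i) //= eqxx big1 ?addr0 ?subrr ?mulr0 ?addr0 // => j /negbTE ->.
have m_near i j : `|m i j - mstar j| <= del.
  rewrite /m addrC addKr normrM gtr0_norm // ler_piMr ?(ltW del0) // mxE.
  have := simplex_le1 mstar j sm; have [p _] := sm; have := p j.
  by rewrite ler_norml; case: (j == i) => /=; lra.
have zone i t : is_s alpha (iter t (phi alpha P0 P1) (m i)) s.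
  apply: nb => j; case: (leqP T0 t) => tT; first exact: hT0.
  apply: le_trans (iter_phi_dist alpha P0 P1 mstar (m i) del t s0 s1 a01 sm (sm_m i)
    fix_ (ltW del0) (m_near i) j) _.
  apply: le_trans delL; rewrite ler_pM2r //.
  apply: (@le_trans _ _ (L ^+ t)); last by rewrite ler_weXn2l // ltnW.
  by rewrite lerXn2r ?nnegrE ?phi_lip_ge0 ?lerDl //; lra.
(* After division by [del], each entry of [w i *m B] is at most [1 / (2 * d)], so its [l1] norm is
   at most [1 / 2]. *)
have [T hT] := attr (del / (2 * d%:R)) (divr_gt0 del0 (mulr_gt0 (ltr0Sn R 1) d0)).
exists T => v v0.
set B := zone_mx P0 P1 s ^+ T.
have wB i j : `|(w i *m B) 0 j| <= (2 * d%:R)^-1.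
  have e := zone_orbit alpha P0 P1 mstar (m i) s T s0 s1 a01 sm (sm_m i) fix_ iss (zone i).
  have e1 : \row_j (m i j - mstar j) = del *: w i.
    by apply/rowP => k; rewrite !mxE /m addrC addKr mxE.
  have := hT T (leqnn T) (m i) (sm_m i) j.
  rewrite e1 -scalemxAl in e; have := congr1 (fun u : 'rV_d => u 0 j) e.
  rewrite /= mxE => ->; rewrite mxE normrM gtr0_norm // => h.
  by rewrite -(ler_pM2l del0).
(* The [mstar] parts of the vectors [w i] cancel because the entries of [v] sum to zero. *)
have vE : v = \sum_i v 0 i *: w i.
  apply/rowP => k; rewrite summxE.
  under eq_bigr do rewrite !mxE mulrBr.
  rewrite sumrB -mulr_suml v0 mul0r subr0 (bigD1 k) //= eqxx mulr1 big1 ?addr0 //.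
  by move=> i /negbTE; rewrite eq_sym => ->; rewrite mulr0.
have -> : l1 v / 2 = \sum_(j < d) l1 v * (2 * d%:R)^-1.
  rewrite sumr_const card_ord -[RHS]mulr_natr; field.
  by rewrite lt0r_neq0.
apply: ler_sum => j _; rewrite {1}vE mulmx_suml summxE.
apply: (le_trans (ler_norm_sum _ _ _)); rewrite mulr_suml.
by apply: ler_sum => i _; rewrite -scalemxAl mxE normrM ler_wpM2l.
Qed.

(** * Empirical measures of sorted configurations *)

Definition empirical (R : realFieldType) {d N : nat} (x : {ffun 'I_N -> 'I_d}) : 'I_d -> R :=
  fracM (counts x).

Lemma countsE {d N} (x : {ffun 'I_N -> 'I_d}) i :
  counts x i = #|[set k | x k == i]| :> nat.
Proof.
by rewrite ffunE inordK // ltnS -[leqRHS](card_ord N) max_card.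
Qed.

Lemma empiricalE {R : realFieldType} {d N} (x : {ffun 'I_N -> 'I_d}) i :
  empirical R x i = (\sum_k (x k == i)%:R) / N%:R.
Proof.
rewrite /empirical /fracM countsE -sum1_card natr_sum big_mkcond /=; congr (_ / _).
by apply: eq_bigr => k _; rewrite inE; case: (x k == i).
Qed.

Lemma empirical_simplex {R : realFieldType} {d N} (x : {ffun 'I_N -> 'I_d}) :
  (0 < N)%N -> simplex (empirical R x).
Proof.
move=> N0; split=> [i|].
  by rewrite empiricalE divr_ge0 // sumr_ge0.
under eq_bigr do rewrite empiricalE.
rewrite -mulr_suml exchange_big /= (eq_bigr (fun=> 1)) => [|k _].
  by rewrite sumr_const card_ord divff // pnatr_eq0 -lt0n.
by rewrite (bigD1 (x k)) //= eqxx big1 ?addr0 // => i /negbTE; rewrite eq_sym => ->.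
Qed.

(** Equal counts make the two value sequences permutations of each other, and sorted permutations
    for an antisymmetric order coincide. *)
Lemma sorted_counts_inj {d N} (x y : {ffun 'I_N -> 'I_d}) :
  sortedb x -> sortedb y -> counts x = counts y -> x = y.
Proof.
move=> sx sy cxy.
have srt (z : {ffun 'I_N -> 'I_d}) : sortedb z ->
    sorted (fun i j : 'I_d => (i <= j)%N) [seq z k | k <- enum 'I_N].
  move=> /forallP sz; rewrite sorted_map.
  have : sorted leq (map val (enum 'I_N)) by rewrite val_enum_ord iota_sorted.
  rewrite sorted_map; apply: sub_sorted => k l /= kl.
  by have /forallP/(_ l)/implyP := sz k; apply.
have cnt (z : {ffun 'I_N -> 'I_d}) i :
    count_mem i [seq z k | k <- enum 'I_N] = counts z i :> nat.
  rewrite countsE count_map cardE -size_filter; congr size.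
  by rewrite {2}/enum_mem -enumT; apply: eq_filter => k; rewrite /= inE.
have : [seq x k | k <- enum 'I_N] = [seq y k | k <- enum 'I_N].
  apply: (@sorted_eq _ (fun i j : 'I_d => (i <= j)%N)); try exact: srt.
  - by move=> a b c; apply: leq_trans.
  - by move=> a b ab; apply/val_inj/anti_leq.
  - by apply/allP => i _ /=; rewrite !cnt cxy.
move=> /eq_in_map e; apply/ffunP => k; apply: e; exact: mem_enum.
Qed.

Lemma card_ord_lt N k : (k <= N)%N -> #|[set i : 'I_N | (i < k)%N]| = k.
Proof.
move=> kN; rewrite -sum1_card.
rewrite (eq_bigl (fun i : 'I_N => (i < k)%N)) => [|i]; last by rewrite inE.
by rewrite (big_ord_narrow kN) /= sum1_card card_ord.
Qed.

(* In a sorted configuration the bandits in states below [l] form an initial segment. *)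
Lemma sorted_initial_card {d N} (x : {ffun 'I_N -> 'I_d}) (K l : nat) :
  sortedb x -> (K <= N)%N ->
  #|[set k : 'I_N | (k < K)%N && (x k < l)%N]| = minn K #|[set k : 'I_N | (x k < l)%N]|.
Proof.
move=> /forallP sx KN.
have sK : [set k : 'I_N | (k < K)%N && (x k < l)%N] \subset [set k : 'I_N | (k < K)%N].
  by apply/subsetP => k; rewrite !inE => /andP[].
have sl : [set k : 'I_N | (k < K)%N && (x k < l)%N] \subset [set k : 'I_N | (x k < l)%N].
  by apply/subsetP => k; rewrite !inE => /andP[].
have cK := card_ord_lt N K KN.
(* Either the first [K] bandits all lie below [l], or some [k0 < K] does not, and then every bandit
   below [l] precedes [k0]. *)
case: (boolP [forall k : 'I_N, (k < K)%N ==> (x k < l)%N]) => [/forallP h|].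
  have eK : [set k : 'I_N | (k < K)%N && (x k < l)%N] = [set k : 'I_N | (k < K)%N].
    by apply/setP => k; rewrite !inE; have := h k; case: (k < K)%N => //= ->.
  rewrite eK in sl *; rewrite cK; apply/esym/minn_idPl.
  by rewrite -{1}cK subset_leq_card.
rewrite negb_forall => /existsP[k0]; rewrite negb_imply -leqNgt => /andP[k0K lx].
have el : [set k : 'I_N | (k < K)%N && (x k < l)%N] = [set k : 'I_N | (x k < l)%N].
  apply/setP => k; rewrite !inE; case: (ltnP (x k) l) => xl; rewrite ?andbF // andbT.
  have : (k < k0)%N.
    rewrite ltnNge; apply/negP => kk; have /forallP/(_ k)/implyP/(_ kk) := sx k0.
    by move=> h; have := leq_trans lx h; rewrite leqNgt xl.
  by move=> /ltn_trans; apply.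
rewrite el in sK *; apply/esym/minn_idPr.
by rewrite -{1}cK subset_leq_card.
Qed.

Lemma sum_lt_split {R : realFieldType} {d N} (P : pred 'I_N) (x : {ffun 'I_N -> 'I_d}) l :
  \sum_(i < d | (i < l)%N) \sum_(k < N | P k) (x k == i)%:R
   = #|[set k : 'I_N | P k && (x k < l)%N]|%:R :> R.
Proof.
rewrite exchange_big /= -sum1_card natr_sum.
rewrite [RHS](eq_bigl (fun k => P k && (x k < l)%N)) => [|k]; last by rewrite inE.
rewrite [RHS]big_mkcondr /=; apply: eq_bigr => k _.
case: ifP => h.
  by rewrite (bigD1 (x k)) //= eqxx big1 ?addr0 // => i /andP[_ /negbTE]; rewrite eq_sym => ->.
by rewrite big1 // => i il; case: eqP => // e; rewrite e il in h.
Qed.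

Lemma cum_empirical {R : realFieldType} {d N} (x : {ffun 'I_N -> 'I_d}) l :
  cum (empirical R x) l = #|[set k : 'I_N | (x k < l)%N]|%:R / N%:R.
Proof.
rewrite /cum; under eq_bigr do rewrite empiricalE.
rewrite -mulr_suml; congr (_ / _); rewrite (sum_lt_split xpredT).
by congr (_%:R); apply: eq_card => k; rewrite !inE.
Qed.

(** Since [alpha * N] is the integer [K], clipping cumulative fractions at [alpha] is the same as
    counting among the first [K] bandits, so no rounding error arises. *)
Lemma active_mass_empirical {R : realFieldType} {d N K} (alpha : R)
  (x : {ffun 'I_N -> 'I_d}) i :
  (0 < N)%N -> (K <= N)%N -> K%:R = alpha * N%:R -> sortedb x ->
  active_mass alpha (empirical R x) i =
    (\sum_(k < N | (k < K)%N) (x k == i)%:R) / N%:R.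
Proof.
move=> N0 KN Ka sx; have n0 : 0 < N%:R :> R by rewrite ltr0n.
have aE : alpha = K%:R / N%:R by rewrite Ka mulfK // lt0r_neq0.
have mE l : Num.min alpha (cum (empirical R x) l) =
   cum (fun i => (\sum_(k < N | (k < K)%N) (x k == i)%:R) / N%:R) l.
  rewrite [RHS]/cum -mulr_suml sum_lt_split sorted_initial_card // natr_min.
  by rewrite cum_empirical aE minr_pMl // invr_ge0 ltW.
by rewrite /active_mass !mE cumS addrC addKr.
Qed.

(** The one-bandit factor of [wip_step_prob], isolated so that the latter is by conversion a product
    law. *)
Definition bandit_law {R : realDomainType} {d N : nat} (K : nat) (P0 P1 : 'M[R]_d)
  (x : {ffun 'I_N -> 'I_d}) (k : 'I_N) (i : 'I_d) : R :=
  if (k < K)%N then P1 (x k) i else P0 (x k) i.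

(** Bandits are grouped by current state: in state [i], [N] times the active mass counts those
    moving by [P1], and the rest move by [P0]. *)
Lemma bandit_law_mean {R : realFieldType} {d N K} (alpha : R) (P0 P1 : 'M[R]_d)
  (x : {ffun 'I_N -> 'I_d}) j :
  0 <= alpha < 1 ->
  (0 < N)%N -> (K <= N)%N -> K%:R = alpha * N%:R -> sortedb x ->
  \sum_k bandit_law K P0 P1 x k j = N%:R * phi alpha P0 P1 (empirical R x) j.
Proof.
move=> a01 N0 KN Ka sx; have n0 : N%:R != 0 :> R by rewrite lt0r_neq0 // ltr0n.
rewrite phi_flow //; last exact: empirical_simplex.
rewrite /mean_flow mulr_sumr.
transitivity (\sum_i \sum_k (x k == i)%:R * (if (k < K)%N then P1 i j else P0 i j)).
  rewrite exchange_big /=; apply: eq_bigr => k _.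
  rewrite (bigD1 (x k)) //= eqxx mul1r big1 ?addr0 // => i /negbTE.
  by rewrite eq_sym => ->; rewrite mul0r.
apply: eq_bigr => i _; rewrite (@active_mass_empirical _ _ _ K) //.
rewrite [X in X - _]empiricalE -mulrBl.
rewrite [X in X - _](bigID (fun k : 'I_N => (k < K)%N)) /= [X in X - _]addrC addrK.
rewrite mulrDr ![_ / _ * _]mulrAC ![N%:R * _]mulrC !divfK //.
rewrite (bigID (fun k : 'I_N => (k < K)%N)) /= !mulr_suml.
by congr (_ + _); apply: eq_bigr => k h; rewrite ?h ?(negbTE h).
Qed.

(** * Stationary laws *)

Lemma product_total {R : comPzRingType} {I T : finType} (p : I -> T -> R) :
  (forall k, \sum_i p k i = 1) -> \sum_(x : {ffun I -> T}) \prod_k p k (x k) = 1.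
Proof. by move=> p1; rewrite -bigA_distr_bigA big1. Qed.

Lemma product_mean {R : comPzRingType} {I T : finType} (p : I -> T -> R) (j : T) :
  (forall k, \sum_i p k i = 1) ->
  \sum_(x : {ffun I -> T}) (\prod_k p k (x k)) * (\sum_k (x k == j)%:R) = \sum_k p k j.
Proof.
move=> p1; under eq_bigr do rewrite mulr_sumr.
rewrite exchange_big /=; apply: eq_bigr => k0 _.
(* The indicator is absorbed into the factor [k0]; the sum then factorizes and all other factors are
   [1]. *)
pose q k i := p k i * (if k == k0 then (i == j)%:R else 1).
rewrite (eq_bigr (fun x : {ffun I -> T} => \prod_k q k (x k))); last first.
  move=> x _; rewrite big_split /=; congr (_ * _).
  by rewrite (bigD1 k0) //= eqxx big1 ?mulr1 // => k /negbTE ->.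
rewrite -bigA_distr_bigA (bigD1 k0) //= [X in _ * X]big1 ?mulr1.
  rewrite (bigD1 j) //= /q !eqxx mulr1 big1 ?addr0 // => i /negbTE ->.
  by rewrite mulr0.
move=> k /negbTE kk; rewrite -[RHS](p1 k); apply: eq_bigr => i _.
by rewrite /q kk mulr1.
Qed.

Lemma bandit_law_ge0 {R : realDomainType} {d N : nat} (K : nat) (P0 P1 : 'M[R]_d)
  (x : {ffun 'I_N -> 'I_d}) k i :
  stochastic P0 -> stochastic P1 -> 0 <= bandit_law K P0 P1 x k i.
Proof. by move=> [p0 _] [p1 _]; rewrite /bandit_law; case: (k < K)%N => /=. Qed.

Lemma bandit_law_sum1 {R : realDomainType} {d N : nat} (K : nat) (P0 P1 : 'M[R]_d)
  (x : {ffun 'I_N -> 'I_d}) k :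
  stochastic P0 -> stochastic P1 -> \sum_i bandit_law K P0 P1 x k i = 1.
Proof. by move=> [_ p0] [_ p1]; rewrite /bandit_law; case: (k < K)%N => /=. Qed.

Lemma wip_step_prob_ge0 {R : realDomainType} {d N : nat} (K : nat) (P0 P1 : 'M[R]_d)
  (x x' : {ffun 'I_N -> 'I_d}) :
  stochastic P0 -> stochastic P1 -> 0 <= wip_step_prob K P0 P1 x x'.
Proof. by move=> s0 s1; apply: prodr_ge0 => k _; apply: (bandit_law_ge0 K P0 P1 x). Qed.

Lemma wip_step_prob_sum1 {R : realDomainType} {d N : nat} (K : nat) (P0 P1 : 'M[R]_d)
  (x : {ffun 'I_N -> 'I_d}) :
  stochastic P0 -> stochastic P1 -> \sum_x' wip_step_prob K P0 P1 x x' = 1.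
Proof.
move=> s0 s1; apply: (product_total (bandit_law K P0 P1 x)) => k.
exact: bandit_law_sum1.
Qed.

Lemma wip_step_mean {R : realFieldType} {d N K} (alpha : R) (P0 P1 : 'M[R]_d)
  (x : {ffun 'I_N -> 'I_d}) j :
  stochastic P0 -> stochastic P1 -> 0 <= alpha < 1 ->
  (0 < N)%N -> (K <= N)%N -> K%:R = alpha * N%:R -> sortedb x ->
  \sum_x' wip_step_prob K P0 P1 x x' * empirical R x' j
    = phi alpha P0 P1 (empirical R x) j.
Proof.
move=> s0 s1 a01 N0 KN Ka sx.
under eq_bigr do rewrite empiricalE mulrA.
rewrite -mulr_suml (product_mean (bandit_law K P0 P1 x)); last first.
  by move=> k; apply: bandit_law_sum1.
by rewrite (bandit_law_mean alpha) // mulrC mulKf // pnatr_eq0 -lt0n.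
Qed.

Definition close {R : realDomainType} {d : nat} (del : R) (m m' : 'I_d -> R) : bool :=
  [forall j, `|m j - m' j| <= del].

(** Union bound over the [d] coordinates, each handled by [product_tail] after centring at the exact
    mean. *)
Lemma wip_step_tail {R : realType} {d N K} (alpha : R) (P0 P1 : 'M[R]_d)
  (x : {ffun 'I_N -> 'I_d}) (del : R) :
  stochastic P0 -> stochastic P1 -> 0 <= alpha < 1 ->
  (0 < N)%N -> (K <= N)%N -> K%:R = alpha * N%:R -> sortedb x -> 0 < del <= 2 ->
  \sum_(x' | ~~ close del (empirical R x') (phi alpha P0 P1 (empirical R x)))
      wip_step_prob K P0 P1 x x'
    <= 2 * d%:R * expR (- (del ^+ 2 / 8 * N%:R)).
Proof.
move=> s0 s1 a01 N0 KN Ka sx del02.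
have n0 : 0 < N%:R :> R by rewrite ltr0n.
pose bad j (x' : {ffun 'I_N -> 'I_d}) :=
  del * N%:R < `|\sum_k ((x' k == j)%:R - bandit_law K P0 P1 x k j)|.
have badE j x' : bad j x' = ~~ (`|empirical R x' j - phi alpha P0 P1 (empirical R x) j| <= del).
  rewrite -ltNge /bad sumrB (bandit_law_mean alpha) // empiricalE.
  rewrite -[X in _ / _ - X](mulKf (lt0r_neq0 n0)) [X in _ / _ - X]mulrC -mulrBl.
  by rewrite normrM normfV (gtr0_norm n0) ltr_pdivlMr.
have -> : 2 * d%:R * expR (- (del ^+ 2 / 8 * N%:R)) =
    \sum_(j < d) 2 * expR (- (del ^+ 2 / 8 * N%:R)).
  by rewrite sumr_const card_ord -[RHS]mulr_natr mulrAC.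
apply: (@le_trans _ _ (\sum_(j < d) \sum_(x' | bad j x') wip_step_prob K P0 P1 x x')); last first.
  apply: ler_sum => j _.
  have := @product_tail R _ _ (bandit_law K P0 P1 x) j del.
  rewrite card_ord; apply=> //.
  - by move=> k i; apply: bandit_law_ge0.
  - by move=> k; apply: bandit_law_sum1.
under [leRHS]eq_bigr do rewrite big_mkcond.
rewrite exchange_big /= big_mkcond; apply: ler_sum => x' _.
have pos := wip_step_prob_ge0 K P0 P1 x x' s0 s1.
case: ifP => [|_]; last by apply: sumr_ge0 => j _; case: ifP.
rewrite /close negb_forall => /existsP[j hj].
rewrite (bigD1 j) //= badE hj lerDl sumr_ge0 // => i _; by case: ifP.
Qed.

Lemma sum_sorted_fiber {R : realFieldType} {d N} (pi : config d N -> R)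
  (H : {ffun 'I_N -> 'I_d} -> R) :
  \sum_n pi n * \sum_(x | (counts x == n) && sortedb x) H x =
  \sum_(x | sortedb x) pi (counts x) * H x.
Proof.
rewrite [RHS](partition_big (@counts d N) predT) //=; apply: eq_bigr => n _.
rewrite mulr_sumr; apply: eq_big => x; first by rewrite andbC.
by move=> /andP[/eqP ->].
Qed.

(** Invariance of expectations, with the kernel unfolded into bandit-level transitions from sorted
    states. *)
Lemma stationary_step {R : realFieldType} {d N K} (P0 P1 : 'M[R]_d)
  (pi : config d N -> R) (f : config d N -> R) :
  stationary K P0 P1 pi ->
  \sum_n pi n * f n =
  \sum_(x | sortedb x) pi (counts x) *
     \sum_x' wip_step_prob K P0 P1 x x' * f (counts x').
Proof.
move=> [_ [_ st]]; rewrite -sum_sorted_fiber.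
under eq_bigr do rewrite st mulr_suml.
rewrite exchange_big /=; apply: eq_bigr => n _.
under eq_bigr do rewrite -mulrA.
rewrite -mulr_sumr; congr (_ * _); rewrite /config_kernel.
under [LHS]eq_bigr do rewrite mulr_suml.
rewrite [LHS]exchange_big /=; apply: eq_bigr => x _.
rewrite [RHS](partition_big (@counts d N) predT) //=; apply: eq_bigr => n' _.
by rewrite mulr_suml; apply: eq_bigr => x' /eqP ->.
Qed.

(* The sorted representative of a configuration is unique, and by stationarity
   it exists for [pi]-almost every configuration. *)
Lemma stationary_sorted {R : realFieldType} {d N K} (P0 P1 : 'M[R]_d)
  (pi : config d N -> R) (f : config d N -> R) :
  stochastic P0 -> stochastic P1 -> stationary K P0 P1 pi ->
  \sum_n pi n * f n = \sum_(x | sortedb x) pi (counts x) * f (counts x).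
Proof.
move=> s0 s1 st; have [pi0 [pi1 _]] := st.
(* The number of sorted representatives of [n], hence [0] or [1]; it is [0] for instance when the
   entries of [n] do not sum to [N]. *)
pose c n : R := \sum_(x : {ffun 'I_N -> 'I_d} | (counts x == n) && sortedb x) 1.
have c1 n : c n <= 1.
  rewrite /c; case: (pickP (fun x : {ffun 'I_N -> 'I_d} => (counts x == n) && sortedb x)).
    move=> x0 /andP[/eqP h1 h2]; rewrite (big_pred1 x0) // => x /=.
    apply/idP/eqP => [/andP[/eqP h3 h4]|->]; last by rewrite h1 eqxx.
    by apply: sorted_counts_inj => //; rewrite h1.
  by move=> h; rewrite big_pred0.
(* Invariance applied to the constant function [1] gives [c] mean [1]; as [c n <= 1], no mass sits
   where [c n < 1]. *)
have tot : \sum_n pi n * c n = 1.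
  have e1 : \sum_n pi n = \sum_n pi n * 1 by apply: eq_bigr => n _; rewrite mulr1.
  rewrite sum_sorted_fiber -[RHS]pi1 e1 (stationary_step _ _ _ _ st).
  apply: eq_bigr => x _; congr (_ * _).
  by under eq_bigr do rewrite mulr1; rewrite wip_step_prob_sum1.
have z n : pi n = pi n * c n.
  apply/eqP; rewrite -subr_eq0; apply/eqP.
  apply: (@psumr_eq0P _ _ predT (fun n => pi n - pi n * c n)) => // [i _|].
    by rewrite subr_ge0 ler_piMr.
  by rewrite sumrB pi1 tot subrr.
rewrite -sum_sorted_fiber; apply: eq_bigr => n _; rewrite {1}z -mulrA; congr (_ * _).
by rewrite mulr_suml; apply: eq_bigr => x /andP[/eqP -> _]; rewrite mul1r.
Qed.

(** * Exponential concentration of the stationary law *)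

Definition prob {R : realFieldType} {d N} (pi : config d N -> R) (A : pred ('I_d -> R)) : R :=
  \sum_(n | A (fracM n)) pi n.

Lemma probE {R : realFieldType} {d N} (pi : config d N -> R) (A : pred ('I_d -> R)) :
  prob pi A = \sum_n pi n * (A (fracM n))%:R.
Proof.
rewrite /prob big_mkcond; apply: eq_bigr => n _.
by case: ifP; rewrite ?mulr1 ?mulr0.
Qed.

Lemma prob_le {R : realFieldType} {d N} (pi : config d N -> R) (A B : pred ('I_d -> R)) :
  (forall n, 0 <= pi n) -> (forall m, A m -> B m) -> prob pi A <= prob pi B.
Proof.
move=> pi0 AB; rewrite !probE; apply: ler_sum => n _; rewrite ler_wpM2l // ler_nat.
by case h: (A _) => //; rewrite (AB _ h).
Qed.

(** By stationarity [B] may be tested one step later, where it fails only if [A] failed before or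
    the step deviated from [phi] by more than [del]. *)
Lemma prob_step {R : realType} {d N K} (alpha : R) (P0 P1 : 'M[R]_d)
  (pi : config d N -> R) (del : R) (A B : pred ('I_d -> R)) :
  stochastic P0 -> stochastic P1 -> 0 <= alpha < 1 ->
  (0 < N)%N -> (K <= N)%N -> K%:R = alpha * N%:R -> stationary K P0 P1 pi ->
  0 < del <= 2 ->
  (forall m m', simplex m -> A m -> close del m' (phi alpha P0 P1 m) -> B m') ->
  prob pi (predC B) <= prob pi (predC A) + 2 * d%:R * expR (- (del ^+ 2 / 8 * N%:R)).
Proof.
move=> s0 s1 a01 N0 KN Ka st del02 AB; have [pi0 [pi1 _]] := st.
set tau := 2 * _ * _.
have tau0 : 0 <= tau by rewrite /tau !mulr_ge0 // expR_ge0.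
have -> : tau = \sum_n pi n * tau by rewrite -mulr_suml pi1 mul1r.
rewrite !probE -big_split /=.
rewrite [leRHS](eq_bigr (fun n => pi n * ((~~ A (fracM n))%:R + tau))); last first.
  by move=> n _; rewrite mulrDr.
rewrite (stationary_step _ _ _ _ st) (stationary_sorted _ _ _ _ s0 s1 st).
apply: ler_sum => x sx; rewrite ler_wpM2l //.
have W0 x' := wip_step_prob_ge0 K P0 P1 x x' s0 s1.
case: (boolP (A (fracM (counts x)))) => hA; rewrite ?add0r; last first.
  apply: (@le_trans _ _ 1); last by rewrite lerDl.
  rewrite -[leRHS](wip_step_prob_sum1 K P0 P1 x s0 s1); apply: ler_sum => x' _.
  by rewrite ler_piMr // lern1 leq_b1.
apply: le_trans (wip_step_tail alpha P0 P1 x del s0 s1 a01 N0 KN Ka sx del02).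
rewrite [leRHS]big_mkcond; apply: ler_sum => x' _.
case: ifP => [_|/negbFE h]; first by rewrite ler_piMr // lern1 leq_b1.
by rewrite (AB _ _ (empirical_simplex x N0) hA h) mulr0.
Qed.

(** Induction on [t] with [prob_step]: each step adds a fresh error [del] and multiplies the earlier
    error by the Lipschitz constant, which produces the geometric sum. *)
Lemma prob_near_orbit {R : realType} {d N K} (alpha : R) (P0 P1 : 'M[R]_d)
  (pi : config d N -> R) (del : R) t :
  stochastic P0 -> stochastic P1 -> 0 <= alpha < 1 ->
  (0 < N)%N -> (K <= N)%N -> K%:R = alpha * N%:R -> stationary K P0 P1 pi ->
  0 < del <= 2 ->
  prob pi (predC (fun m => `[< exists2 m0, simplex m0 &
      close (del * \sum_(u < t) phi_lip R d ^+ u) m (iter t (phi alpha P0 P1) m0) >]))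
    <= t%:R * (2 * d%:R * expR (- (del ^+ 2 / 8 * N%:R))).
Proof.
move=> s0 s1 a01 N0 KN Ka st del02; have [pi0 [pi1 _]] := st.
have del0 : 0 <= del by case/andP: del02 => /ltW.
elim: t => [|t IH].
  rewrite mul0r probE (stationary_sorted _ _ _ _ s0 s1 st) big1 // => x _ /=.
  rewrite (asboolT (P := exists2 _, _ & _)) ?mulr0 //.
  (* At time [0] the measure is its own starting point. *)
  exists (fracM (counts x)); first exact: empirical_simplex.
  by apply/forallP => j; rewrite subrr normr0 big_ord0 mulr0.
rewrite -[t.+1]addn1 natrD mulrDl mul1r; apply: le_trans (lerD IH (lexx _)).
apply: (prob_step alpha P0 P1 pi del _ _ s0 s1 a01 N0 KN Ka st del02).
move=> m m' sm /asboolP[m0 sm0 /forallP h] /forallP h'.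
rewrite addn1; apply/asboolP; exists m0 => //; apply/forallP => j.
set S := \sum_(u < t) _ in h.
have -> : \sum_(u < t.+1) phi_lip R d ^+ u = 1 + phi_lip R d * S.
  by rewrite big_ord_recl expr0 mulr_sumr; congr (_ + _); apply: eq_bigr => u _; rewrite -exprS.
have S0 : 0 <= S by apply: sumr_ge0 => u _; rewrite exprn_ge0 // phi_lip_ge0.
rewrite iterS.
have h2 := phi_dist alpha P0 P1 m _ (del * S) j s0 s1 a01 sm
  (iter_phi_simplex alpha P0 P1 m0 t s0 s1 a01 sm0) (mulr_ge0 del0 S0) h.
rewrite (le_trans (ler_distD (phi alpha P0 P1 m j) _ _)) // (le_trans (lerD (h' j) h2)) //.
by rewrite mulrDr mulr1 mulrCA.
Qed.

(** The horizon [T] depends on [eps] but not on [N]. Half of [eps] pays for the distance from the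
    [T]-th iterate to [mstar], half for the noise accumulated over [T] steps. *)
Lemma prob_far {R : realType} {d} (alpha : R) (P0 P1 : 'M[R]_d) (mstar : 'I_d -> R) (eps : R) :
  stochastic P0 -> stochastic P1 -> 0 <= alpha < 1 ->
  uniform_global_attractor (phi alpha P0 P1) mstar -> 0 < eps ->
  exists b c : R, 0 < b /\ 0 < c /\ forall N K (pi : config d N -> R),
    (0 < N)%N -> (K <= N)%N -> K%:R = alpha * N%:R -> stationary K P0 P1 pi ->
    prob pi (predC (fun m => close eps m mstar)) <= b * expR (- (c * N%:R)).
Proof.
move=> s0 s1 a01 attr eps0.
have eps20 : 0 < eps / 2 by rewrite divr_gt0.
have [T hT] := attr _ eps20.
pose S : R := \sum_(u < T) phi_lip R d ^+ u.
have S0 : 0 <= S by apply: sumr_ge0 => u _; rewrite exprn_ge0 // phi_lip_ge0.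
have S1 : 0 < S + 1 by lra.
(* The cap [2] is the range of the tail bound; [S + 1] is positive even when [T] is [0]. *)
pose del := Num.min 2 (eps / 2 / (S + 1)).
have del0 : 0 < del by rewrite lt_min ltr0n divr_gt0.
have del02 : 0 < del <= 2 by rewrite del0 ge_min lexx.
have delS : del * S <= eps / 2.
  apply: (@le_trans _ _ (del * (S + 1))); first by rewrite ler_pM2l // lerDl.
  by rewrite -ler_pdivlMr // ge_min lexx orbT.
exists (T%:R * (2 * d%:R) + 1), (del ^+ 2 / 8).
split; first by rewrite ltr_wpDl // mulr_ge0 // mulr_ge0.
split; first by rewrite divr_gt0 // exprn_gt0.
move=> N K pi N0 KN Ka st; have [pi0 _] := st.
have := prob_near_orbit alpha P0 P1 pi del T s0 s1 a01 N0 KN Ka st del02.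
rewrite -/S mulrA => h; rewrite mulrDl mul1r.
apply: le_trans (le_trans h _); last by rewrite lerDl expR_ge0.
apply: prob_le => // m; apply: contra => /asboolP[m0 sm0 /forallP hm].
apply/forallP => j.
rewrite (le_trans (ler_distD (iter T (phi alpha P0 P1) m0 j) _ _)) //.
by have := hm j; have := hT T (leqnn T) m0 sm0 j; lra.
Qed.

(** * Bias of the stationary mean *)

Lemma mean_bias {R : realFieldType} {d N K} (alpha : R) (P0 P1 : 'M[R]_d)
  (mstar : 'I_d -> R) s (pi : config d N -> R) :
  stochastic P0 -> stochastic P1 -> 0 <= alpha < 1 -> simplex mstar ->
  (forall j, phi alpha P0 P1 mstar j = mstar j) -> is_s alpha mstar s ->
  (0 < N)%N -> (K <= N)%N -> K%:R = alpha * N%:R -> stationary K P0 P1 pi ->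
  let e := \row_j (\sum_n pi n * fracM n j - mstar j) in
  \sum_i e 0 i = 0 /\
  exists2 r, e = e *m zone_mx P0 P1 s + r &
    l1 r <= d%:R * ((1 + 2 * d%:R) * prob pi (predC (fun m => is_s alpha m s))).
Proof.
move=> s0 s1 a01 sm fix_ iss N0 KN Ka st e; have [pi0 [pi1 _]] := st.
have w1 : \sum_(x | sortedb x) pi (counts x) = 1.
  have e1 : \sum_n pi n = \sum_n pi n * 1 by apply: eq_bigr => n _; rewrite mulr1.
  by rewrite -pi1 e1 (stationary_sorted _ _ _ _ s0 s1 st); apply: eq_bigr => x _; rewrite mulr1.
have eE j : e 0 j = \sum_(x | sortedb x) pi (counts x) * (empirical R x j - mstar j).
  rewrite mxE (stationary_sorted _ _ _ _ s0 s1 st).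
  by under [RHS]eq_bigr do rewrite mulrBr; rewrite sumrB -mulr_suml w1 mul1r.
(* The same bias computed one step later: stationarity replaces the empirical measure by its image
   under [phi]. *)
have eE' j : e 0 j = \sum_(x | sortedb x)
    pi (counts x) * (phi alpha P0 P1 (empirical R x) j - mstar j).
  rewrite mxE (stationary_step _ _ _ _ st).
  under [RHS]eq_bigr do rewrite mulrBr; rewrite sumrB -mulr_suml w1 mul1r; congr (_ - _).
  by apply: eq_bigr => x sx; congr (_ * _); apply: wip_step_mean.
split.
  under eq_bigr do rewrite eE; rewrite exchange_big /= big1 // => x _.
  have [_ q] := empirical_simplex (R := R) x N0; have [_ q'] := sm.
  by rewrite -mulr_sumr sumrB q q' subrr mulr0.
pose A := zone_mx P0 P1 s.
(* The defect of linearity of [phi] around [mstar]: zero in the zone, and outside it at most [1] for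
   the difference of two simplex points plus [2] for each of [d] matrix terms. *)
pose rho (m : 'I_d -> R) j := phi alpha P0 P1 m j - mstar j - \sum_i (m i - mstar i) * A i j.
exists (\row_j \sum_(x | sortedb x) pi (counts x) * rho (empirical R x) j).
  apply/rowP => j; rewrite eE' !mxE.
  have -> : \sum_i e 0 i * zone_mx P0 P1 s i j =
     \sum_(x | sortedb x) pi (counts x) * \sum_i (empirical R x i - mstar i) * A i j.
    under eq_bigr do rewrite eE mulr_suml.
    rewrite exchange_big /=; apply: eq_bigr => x _; rewrite mulr_sumr.
    by apply: eq_bigr => i _; rewrite mulrA.
  rewrite -big_split /=; apply: eq_bigr => x _.
  by rewrite -mulrDr /rho [X in _ = _ * X]addrC subrK.
have rho_le m j : simplex m -> `|rho m j| <= (1 + 2 * d%:R) * (~~ is_s alpha m s)%:R.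
  move=> smm; case: (boolP (is_s alpha m s)) => hs; rewrite ?mulr0 ?mulr1.
    rewrite /rho -{1}(fix_ j) !(phi_is_s _ _ _ _ s) //; try by case: smm sm => ? _ [].
    rewrite !phi_s_affine opprD addrACA subrr addr0 -sumrB.
    under [X in _ - X]eq_bigr do rewrite mulrBl.
    by rewrite subrr normr0.
  rewrite /rho (le_trans (ler_normB _ _)) // lerD //.
    have sp := phi_simplex alpha P0 P1 m s0 s1 a01 smm.
    have [p _] := sp; have := p j; have := simplex_le1 _ j sp.
    have [p' _] := sm; have := p' j; have := simplex_le1 _ j sm.
    by rewrite ler_norml; lra.
  rewrite (le_trans (ler_norm_sum _ _ _)) // mulr_natr -[X in _ *+ X](card_ord d) -sumr_const.
  apply: ler_sum => i _; rewrite normrM -[leRHS]mul1r ler_pM ?zone_mx_le2 //.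
  have [p _] := smm; have := p i; have := simplex_le1 _ i smm.
  have [p' _] := sm; have := p' i; have := simplex_le1 _ i sm.
  by rewrite ler_norml; lra.
rewrite mulr_natl -[X in _ *+ X](card_ord d) -sumr_const /l1.
apply: ler_sum => j _; rewrite mxE probE (stationary_sorted _ _ _ _ s0 s1 st).
rewrite (le_trans (ler_norm_sum _ _ _)) // mulr_sumr; apply: ler_sum => x _.
rewrite normrM ger0_norm // mulrCA ler_wpM2l //.
exact/rho_le/empirical_simplex.
Qed.

Theorem mainTheorem10 (R : realType) (d : nat) (P0 P1 : 'M[R]_d)
  (R0 R1 : 'I_d -> R) (alpha : R) (mstar : 'I_d -> R) :
  stochastic P0 -> stochastic P1 -> 0 < alpha < 1 ->
  unichain P0 P1 ->
  strictly_indexable_labeled P0 P1 R0 R1 ->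
  simplex mstar ->
  (forall j, phi alpha P0 P1 mstar j = mstar j) ->
  uniform_global_attractor (phi alpha P0 P1) mstar ->
  ~ singular alpha mstar ->
  exists b c : R, 0 < b /\ 0 < c /\
    forall (N K : nat) (pi : config d N -> R),
      (0 < N)%N -> K%:R = alpha * N%:R ->
      stationary K P0 P1 pi ->
      (forall i : 'I_d,
         `| \sum_(n : config d N) pi n * fracM n i - mstar i |
           <= b * expR (- (c * N%:R))) /\
      (forall s : 'I_d, is_s alpha mstar s ->
         \sum_(n : config d N | ~~ is_s alpha (fracM n) s) pi n
           <= b * expR (- (c * N%:R))).
Proof.
move=> s0 s1 a01 _ _ sm fix_ attr ns.
have a01' : 0 <= alpha < 1 by case/andP: a01 => /ltW -> ->.
have [s iss] := is_s_exists alpha mstar a01' sm.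
have [eps eps0 nb] := zone_nbhd alpha mstar s (proj1 (andP a01)) iss ns.
have [b [c [b0 [c0 far]]]] := prob_far alpha P0 P1 mstar eps s0 s1 a01' attr eps0.
have [T hT] := zone_contraction alpha P0 P1 mstar s s0 s1 a01 sm fix_ attr ns iss.
have [C C0 pert] := perturbation_bound (zone_mx P0 P1 s) 2 T
  (fun i j => zone_mx_le2 P0 P1 s i j s0 s1) (ler0n _ 2) hT.
(* [D] turns the probability of leaving the zone into a bound on the bias; [D + 1] then covers both
   conclusions with one constant. *)
pose D := C * (d%:R * (1 + 2 * d%:R)).
have D0 : 0 <= D by rewrite !mulr_ge0 // addr_ge0 ?mulr_ge0.
exists ((D + 1) * b), c; split; first by rewrite mulr_gt0 // ltr_wpDl.
split=> // N K pi N0 Ka st; have [pi0 _] := st.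
have KN : (K <= N)%N.
  rewrite -(ler_nat R) Ka ler_piMl //; by case/andP: a01 => _ /ltW.
have hP : prob pi (predC (fun m => is_s alpha m s)) <= b * expR (- (c * N%:R)).
  apply: le_trans (far N K pi N0 KN Ka st); apply: prob_le => // m.
  by apply: contra => /forallP hm; apply: nb.
have bE0 : 0 <= b * expR (- (c * N%:R)) by rewrite mulr_ge0 ?expR_ge0 // ltW.
rewrite -mulrA; split=> [i|s' iss']; last first.
  rewrite -(is_s_uniq alpha mstar s s' (proj1 sm) iss iss').
  by apply: (le_trans hP); rewrite ler_peMl // lerDr.
have [e0 [r er rle]] := mean_bias alpha P0 P1 mstar s pi s0 s1 a01' sm fix_ iss N0 KN Ka st.
have := pert _ _ e0 er; set e := \row_j _ => he.
have -> : \sum_n pi n * fracM n i - mstar i = e 0 i by rewrite mxE.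
(* A single coordinate is bounded by the [l1] norm, in which the contraction was stated. *)
apply: (@le_trans _ _ (l1 e)); first by rewrite /l1 (bigD1 i) //= lerDl sumr_ge0.
apply: (le_trans he); apply: (@le_trans _ _ (D * (b * expR (- (c * N%:R))))).
  rewrite /D -mulrA ler_wpM2l // (le_trans rle) // -[leRHS]mulrA ler_wpM2l //.
  by rewrite ler_wpM2l // addr_ge0 ?mulr_ge0.
by rewrite ler_wpM2r // lerDl.
Qed.
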